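(* For every $\varepsilon>0$ there exist constants $p_0=p_0(\varepsilon)$ and $c=c(\varepsilon)>0$, depending only on $\varepsilon$, such that for every prime $p\ge p_0$, every integer $g\ge 2$ with $\gcd(g,p)=1$ of multiplicative order $t$ modulo $p$, every integer $M$ with $1\le M<t$, every integer $a$ with $\gcd(a,p)=1$, and all integers $K,L$, $$J_a(M;K,L)< c\,\bigl(1+M^{3/4}p^{-1/4}\bigr)M^{1/2+\varepsilon}.$$
   Context: $J_a(M;K,L)$ denotes the number of pairs of integers $(x,y)$ with $y\equiv a g^x\pmod p$, $x\in[K+1,K+M]$, $y\in[L+1,L+M]$; for negative $x$, $g^x$ is understood via the inverse of $g$ modulo $p$. *)

(* Defs.v *)
From HB Require Import structures.
From mathcomp Require Import all_boot all_order all_algebra.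

Set Implicit Arguments.
Unset Strict Implicit.
Unset Printing Implicit Defensive.

Import Order.TTheory GRing.Theory Num.Theory.
Local Open Scope ring_scope.

(* The congruence y = a * g ^ x modulo a prime p, as an equality in the field  *)
(* 'F_p, so that for x < 0 the power g ^ x is taken with the inverse of g      *)
(* modulo p.                                                                   *)
Definition exp_congr (p : nat) (g a x y : int) : bool :=
  (y%:~R : 'F_p) == a%:~R * (g%:~R : 'F_p) ^ x.

(* J_a(M; K, L): an index i < M stands for the integer K + 1 + i, which runs   *)
(* over [K + 1, K + M]; likewise for L.                                        *)
Definition J (p : nat) (g a : int) (M : nat) (K L : int) : nat :=
  #|[set ij : 'I_M * 'I_M |
      exp_congr p g a (K + 1 + (ij.1 : nat)%:Z) (L + 1 + (ij.2 : nat)%:Z)]|.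

(* Main.v *)
Require Import Defs.
From HB Require Import structures.
From mathcomp Require Import all_boot all_order all_algebra finfield.
From mathcomp Require Import all_classical all_reals all_analysis.
From mathcomp Require Import zify ring lra.

(** Adding the exponents of two points (x1, y1), (x2, y2) counted by J gives
    y1 * y2 = a ^+ 2 * g ^ (x1 + x2), and x1 + x2 takes fewer than 2M values;
    as M < t the y's determine the x's, so J ^ 2 <= 2M * N, where N counts the
    solutions in [0, M)^2 of (l + u) (l + v) = lam mod p for some lam <> 0.

    If 4 M^3 < p, two solutions with distinct sums u + v allow l to be
    eliminated: the other solutions satisfy an equation
    (A u + B) (A v + B) = D over the integers, with 0 < |D| <= 9 M^4.  If
    p <= 4 M^3, Dirichlet's theorem gives t = O(sqrt (p / M)) and
    l0 = O(sqrt (p M)) with t l = l0 mod p, and t u v + l0 (u + v) then lies in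
    O(1 + M^(3/2) p^(-1/2)) integers of a fixed class mod p; each of them gives
    an equation (t u + l0) (t v + l0) = D with 0 < |D| <= 4 p^4.  As D is at
    most a power of M in both cases, the divisor bound gives M^o(1) solutions
    of each equation. *)

Set Implicit Arguments.
Unset Strict Implicit.
Unset Printing Implicit Defensive.

Import Order.TTheory GRing.Theory Num.Theory.
Local Open Scope ring_scope.

(** * The divisor bound *)

Section Divisors.
Local Open Scope nat_scope.

(** A divisor [d] of [m * n] is the product of [gcdn d m], which divides [m], and [d %/ gcdn d m],
    which is coprime to [m %/ gcdn d m] and hence divides [n]. *)
Lemma size_divisorsM m n : 0 < m -> 0 < n ->
  size (divisors (m * n)) <= size (divisors m) * size (divisors n).
Proof.
move=> m0 n0; rewrite -(size_allpairs muln); apply: uniq_leq_size.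
  exact: divisors_uniq.
move=> d; rewrite -dvdn_divisors ?muln_gt0 ?m0 // => dmn.
have d0 : 0 < d by apply: dvdn_gt0 dmn; rewrite muln_gt0 m0.
have g0 : 0 < gcdn d m by rewrite gcdn_gt0 d0.
apply/allpairsP; exists (gcdn d m, d %/ gcdn d m) => /=; split.
- by rewrite -dvdn_divisors // dvdn_gcdr.
- rewrite -dvdn_divisors // -(@Gauss_dvdr _ (m %/ gcdn d m)).
    by rewrite -(dvdn_pmul2l g0) mulnA ![gcdn d m * _]mulnC !divnK
      ?dvdn_gcdl ?dvdn_gcdr.
  by rewrite /coprime -(eqn_pmul2l g0) muln_gcdr ![gcdn d m * _]mulnC !divnK
      ?dvdn_gcdl ?dvdn_gcdr // mul1n.
- by rewrite mulnC divnK // dvdn_gcdl.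
Qed.

Lemma size_divisors_pfactor q e : prime q -> size (divisors (q ^ e)) <= e.+1.
Proof.
move=> pq; rewrite -(size_iota 0 e.+1) -(size_map (expn q) (iota 0 e.+1)).
apply: uniq_leq_size => [|d]; first exact: divisors_uniq.
rewrite -dvdn_divisors ?expn_gt0 ?prime_gt0 // => /(dvdn_pfactor _ _ pq)[i le_ie ->].
by rewrite map_f // mem_iota.
Qed.

Lemma leq_bin_exp2 n k : 'C(n, k) <= 2 ^ n.
Proof.
have [le_kn|/bin_small ->//] := leqP k n.
rewrite -[2]/(1 + 1) expnDn (bigD1 (inord k)) //= !exp1n !muln1 inordK //.
exact: leq_addr.
Qed.

(** The falling factorial [(e + k) ^_ k] has [k] factors, all at least [e.+1], and equals [k!] times
    a binomial coefficient, itself at most [2 ^ (e + k)]. *)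
Lemma expn_leq_exp2 k e : e.+1 ^ k <= k`! * 2 ^ k * 2 ^ e.
Proof.
have le_ff : e.+1 ^ k <= (e + k) ^_ k.
  rewrite ffact_prod -[k in e.+1 ^ k]card_ord -prod_nat_const.
  by apply: leq_prod => i _; have := ltn_ord i; lia.
apply: leq_trans le_ff _; rewrite -bin_ffact mulnC -mulnA leq_pmul2l ?fact_gt0 //.
by rewrite -expnD addnC leq_bin_exp2.
Qed.

Lemma leqW_exp2r k m n : m <= n -> m ^ k <= n ^ k.
Proof. by case: k => [|k] le_mn; rewrite ?expn0 ?leq_exp2r. Qed.

(** The comparison is made prime by prime. Only primes below [2 ^ k] cost a factor [B], and there
    are at most [2 ^ k] of them, so the loss is independent of [n]. *)
Lemma divisor_bound k : exists2 C, 0 < C &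
  forall n, 0 < n -> size (divisors n) ^ k <= C * n.
Proof.
pose B := k`! * 2 ^ k.
have B0 : 0 < B by rewrite muln_gt0 fact_gt0 expn_gt0.
exists (B ^ (2 ^ k)) => [|n n0]; first by rewrite expn_gt0 B0.
(* The local factor is at most 1 once [2 ^ k <= q]. *)
pose w q := if q < 2 ^ k then B else 1.
have local_bound q e : prime q -> size (divisors (q ^ e)) ^ k <= w q * q ^ e.
  move=> pq; have q1 := prime_gt1 pq.
  apply: (@leq_trans (e.+1 ^ k)); first exact/leqW_exp2r/size_divisors_pfactor.
  rewrite /w; case: ltnP => q2k.
    apply: leq_trans (expn_leq_exp2 k e) _; rewrite leq_mul2l.
    by apply/orP; right; apply: leqW_exp2r.
  (* For a large prime, [e.+1 <= 2 ^ e] and [(2 ^ e) ^ k = (2 ^ k) ^ e <= q ^ e]. *)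
  rewrite mul1n; apply: (@leq_trans ((2 ^ e) ^ k)).
    by apply: leqW_exp2r; rewrite ltn_expl.
  by rewrite -expnM mulnC expnM; apply: leqW_exp2r.
have prod_bound (s : seq nat) : all prime s ->
    size (divisors (\prod_(q <- s) q ^ logn q n)) ^ k <=
    (\prod_(q <- s) w q) * \prod_(q <- s) q ^ logn q n.
  elim: s => [_|q s IH /= /andP[pq ps]]; first by rewrite !big_nil exp1n.
  rewrite !big_cons mulnACA.
  apply: leq_trans (leq_mul (local_bound _ _ pq) (IH ps)).
  rewrite -expnMn; apply/leqW_exp2r/size_divisorsM; rewrite ?expn_gt0 ?(prime_gt0 pq) //.
  rewrite big_seq; apply: prodn_cond_gt0 => r rs.
  by rewrite expn_gt0 prime_gt0 // (allP ps).
have allp : all prime (primes n) by apply/allP => q; rewrite mem_primes; case/and3P.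
have := prod_bound _ allp.
have -> : \prod_(q <- primes n) q ^ logn q n = n.
  by rewrite [RHS]prod_prime_decomp // prime_decompE big_map.
move/leq_trans; apply; rewrite leq_mul2r; apply/orP; right.
rewrite -big_mkcond big_const_seq iter_muln_1 leq_pexp2l //.
rewrite -size_filter -[X in _ <= X](size_iota 0) uniq_leq_size //.
  by rewrite filter_uniq ?primes_uniq.
by move=> q; rewrite mem_filter mem_iota => /andP[].
Qed.
End Divisors.

(** * Pigeonhole, Dirichlet approximation and integer hyperbolas *)

Lemma pigeonhole (T : finType) n (f : T -> 'I_n) (S : {set T}) : (0 < n)%N ->
  exists c, (#|S| <= n * #|[set x in S | f x == c]|)%N.
Proof.
move=> n0; pose c0 := Ordinal n0.
pose c := [arg max_(c > c0) #|[set x in S | f x == c]|]%N.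
exists c; rewrite -sum1_card (partition_big f xpredT) //=.
rewrite -[n in (n * _)%N]card_ord -sum_nat_const leq_sum // => i _.
rewrite (_ : (\sum_(j in S | f j == i) 1 = #|[set x in S | f x == i]|)%N).
  by rewrite /c; case: arg_maxnP => // j _; apply.
by rewrite -sum1_card; apply: eq_bigl => x; rewrite inE.
Qed.

Lemma dvdz_norm_lt (p : nat) (z : int) : (p %| z)%Z -> `|z| < p%:Z -> z = 0.
Proof.
move=> pz lt_zp; apply/eqP; rewrite -absz_eq0; apply/negPn/negP.
by rewrite -lt0n => z0; have := dvdn_leq z0 pz; lia.
Qed.

Lemma Euclid_dvdzM (p : nat) (x y : int) : prime p ->
  (p %| x * y)%Z = (p %| x)%Z || (p %| y)%Z.
Proof. by move=> pp; rewrite !dvdzE abszM Euclid_dvdM. Qed.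

(** Among the [T + 1] residues of [0, l, ..., T l], two fall in the same one of [T] boxes of length
    [p / T]; their difference gives [t] and [l0]. *)
Lemma dirichlet_approximation (p T : nat) (l : int) : (0 < p)%N -> (0 < T)%N ->
  exists (t : nat) (l0 : int),
    [/\ (0 < t <= T)%N, (`|l0| * T < p)%N & (p %| t%:Z * l - l0)%Z].
Proof.
move=> p0 T0; pose r (j : nat) := `|((j%:Z * l) %% p)%Z|%N.
have rE j : (r j)%:Z = ((j%:Z * l) %% p)%Z by rewrite /r gez0_abs // modz_ge0; lia.
have r_lt j : (r j < p)%N by rewrite -ltz_nat rE ltz_pmod.
have box_lt j : (r j * T %/ p < T)%N by rewrite ltn_divLR // mulnC ltn_pmul2l.
have /injectivePn[i [j neq_ij /(congr1 val)/= eq_box]] :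
    ~~ injectiveb (fun j : 'I_T.+1 => Ordinal (box_lt j)).
  by apply/negP => /injectiveP/leq_card; rewrite !card_ord ltnn.
wlog lt_ij : i j neq_ij eq_box / (i < j)%N => [wl|].
  case: (ltngtP i j) => [|/wl|/val_inj ij]; [exact: wl | | by rewrite ij eqxx in neq_ij].
  by apply; rewrite // eq_sym.
exists (j - i)%N, ((r j)%:Z - (r i)%:Z); split.
- by have := ltn_ord j; lia.
- have := divn_eq (r i * T) p; have := divn_eq (r j * T) p.
  have := ltn_pmod (r i * T) p0; have := ltn_pmod (r j * T) p0.
  rewrite eq_box; nia.
- rewrite !rE; apply/dvdzP.
  exists ((j%:Z * l %/ p)%Z - (i%:Z * l %/ p)%Z).
  have := divz_eq (j%:Z * l) p; have := divz_eq (i%:Z * l) p.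
  rewrite -subzn ?(ltnW lt_ij) //. nia.
Qed.

(** The first factor is a divisor of [D] up to sign, and as [D] is nonzero it determines the second;
    [A != 0] then recovers both coordinates. *)
Lemma card_int_hyperbola M (A B D : int) (S : {set 'I_M * 'I_M}) :
  A != 0 -> D != 0 ->
  (forall w, w \in S ->
     (A * (w.1 : nat)%:Z + B) * (A * (w.2 : nat)%:Z + B) = D) ->
  (#|S| <= 2 * size (divisors `|D|))%N.
Proof.
move=> A0 D0 SD; pose f (w : 'I_M * 'I_M) : int := A * (w.1 : nat)%:Z + B.
have inj_f : {in S &, injective f}.
  move=> [u v] [u' v'] /SD /= D1 /SD /= D2; rewrite /f /= => eq_u.
  have cancel (x y : 'I_M) : A * (x : nat)%:Z + B = A * (y : nat)%:Z + B -> x = y.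
    by move=> /addIr/(mulfI A0)[/val_inj].
  have f0 : A * (u' : nat)%:Z + B != 0 by apply: contra_neq D0 => z; rewrite -D2 z mul0r.
  rewrite (cancel u u' eq_u) (cancel v v' _) //; apply: (mulfI f0).
  by rewrite D2 -D1 eq_u.
pose ds := divisors `|D|.
rewrite cardE -(size_map f).
apply: leq_trans (_ : size ([seq n%:Z | n <- ds] ++ [seq - n%:Z | n <- ds]) <= _)%N; last first.
  by rewrite size_cat !size_map addnn mul2n.
apply: uniq_leq_size.
  rewrite map_inj_in_uniq ?enum_uniq // => x y; rewrite !mem_enum; exact: inj_f.
move=> _ /mapP[w + ->]; rewrite mem_enum => /SD fD.
have : (`|f w| \in ds)%N.
  by rewrite -dvdn_divisors ?absz_gt0 // -fD abszM dvdn_mulr.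
by rewrite mem_cat; case: (intP (f w)) => [|n|n] fw; apply/orP; 
  [left|left|right]; apply/mapP; eexists; try exact: fw.
Qed.

(** * Choice of the Dirichlet parameter *)

Section DirichletParameter.
Local Open Scope nat_scope.

(** [T] is the integer part of the square root of [p / M], which balances [T M^2] against [M p / T],
    the two terms of the later bound. *)
Lemma sqrt_ratio (p M : nat) : 0 < M < p ->
  exists T, [/\ 0 < T, T < p, T ^ 2 * M <= p & p < 4 * T ^ 2 * M].
Proof.
move=> /andP[M0 ltMp].
pose P T := (0 < T) && (T ^ 2 * M <= p).
have exP : exists T, P T by exists 1; rewrite /P exp1n mul1n (ltnW ltMp).
have leP T : P T -> T <= p.
  move=> /andP[T0]; apply: leq_trans.
  by rewrite -mulnn -mulnA leq_pmulr // muln_gt0 T0.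
case: (ex_maxnP exP leP) => T /andP[T0 T_le] T_max; exists T; split=> //.
  rewrite ltnNge; apply/negP => le_pT; have : p * p <= p.
    by apply: leq_trans T_le; rewrite -mulnn -[p * p]muln1 !leq_mul.
  by rewrite -[X in _ <= X]muln1 leq_pmul2l; lia.
rewrite ltnNge; apply/negP => p_ge; suff /T_max : P T.+1 by rewrite ltnn.
rewrite /P /=; apply: leq_trans p_ge; rewrite leq_mul2r; apply/orP; right.
by rewrite -[4]/(2 ^ 2) -expnMn leq_exp2r //; lia.
Qed.

Lemma quotient_count (p M T a Z : nat) : 0 < M -> 0 < p -> 0 < T ->
  T ^ 2 * M <= p -> p < 4 * T ^ 2 * M -> a * T < p ->
  Z * p <= T * M ^ 2 + 2 * M * a -> Z ^ 2 * p <= 25 * M ^ 3.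
Proof.
move=> M0 p0 T0 T_le p_lt a_lt Z_le.
have aT_le : a ^ 2 * T ^ 2 <= p ^ 2 by rewrite -expnMn leq_exp2r // ltnW.
have a_le : a ^ 2 <= 4 * p * M.
  rewrite -(leq_pmul2r p0); apply: leq_trans (_ : a ^ 2 * (4 * T ^ 2 * M) <= _).
    by rewrite leq_mul2l (ltnW p_lt) orbT.
  by move: (leq_mul aT_le (leqnn (4 * M))); lia.
have X_le : (T * M ^ 2) ^ 2 <= p * M ^ 3.
  by move: (leq_mul T_le (leqnn (M ^ 3))); lia.
have Y_le : (2 * M * a) ^ 2 <= 16 * (p * M ^ 3).
  by move: (leq_mul a_le (leqnn (4 * M ^ 2))); lia.
rewrite -(leq_pmul2r p0).
have : (Z * p) ^ 2 <= (T * M ^ 2 + 2 * M * a) ^ 2 by rewrite leq_exp2r.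
move: X_le Y_le; set X := T * M ^ 2; set Y := 2 * M * a.
(* The bounds on [X] and [Y] are in ratio 1 to 4, so the cross term is estimated with weight 4; this
   gives [25 = (1 + 4)^2]. *)
have [XY_le _] := nat_Cauchy (4 * X) Y; move: XY_le.
rewrite sqrnD !expnMn; clearbody X Y; lia.
Qed.
End DirichletParameter.

(** * Points of a small box on a modular hyperbola *)

Lemma eq_dvdz (d x y : int) : x = y -> (d %| x)%Z -> (d %| y)%Z.
Proof. by move=> ->. Qed.

Lemma PoszX (m k : nat) : (m ^ k)%N%:Z = m%:Z ^+ k.
Proof. by rewrite -!natz natrX. Qed.

Lemma shift_bound (Z : nat) (a : int) : `|a| <= Z%:Z -> (absz (a + Z%:Z)%R < (2 * Z).+1)%N.
Proof. by lia. Qed.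

Lemma shift_inj (Z : nat) (a b : int) : `|a| <= Z%:Z -> `|b| <= Z%:Z ->
  absz (a + Z%:Z) = absz (b + Z%:Z) -> a = b.
Proof. by lia. Qed.

Section ModularHyperbola.
Variables (p M : nat) (l lam : int) (S : {set 'I_M * 'I_M}).
Hypotheses (pp : prime p) (lam0 : ~~ (p %| lam)%Z).
Hypothesis S_hyp : forall w, w \in S ->
  (p %| (l + (w.1 : nat)%:Z) * (l + (w.2 : nat)%:Z) - lam)%Z.

Lemma hyperbola_shift_ndvd w : w \in S -> ~~ (p %| l + (w.1 : nat)%:Z)%Z /\
  ~~ (p %| l + (w.2 : nat)%:Z)%Z.
Proof.
move=> /S_hyp/dvdzP[k hk]; split; apply: contra lam0 => /dvdzP[j hj]; apply/dvdzP.
  exists (j * (l + (w.2 : nat)%:Z) - k).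
  by rewrite mulrBl -hk hj; ring.
exists (j * (l + (w.1 : nat)%:Z) - k).
by rewrite mulrBl -hk hj; ring.
Qed.

(** Modulo [p] each factor [A * x + B] is [A * (l + x)], and [p] divides neither [A] nor [l + x].
    This supplies the nonzero [D] that [card_int_hyperbola] requires. *)
Lemma affine_values_neq0 (A B : int) w : ~~ (p %| A)%Z -> (p %| A * l - B)%Z ->
  w \in S -> (A * (w.1 : nat)%:Z + B) * (A * (w.2 : nat)%:Z + B) != 0.
Proof.
move=> pA pB /hyperbola_shift_ndvd[pu pv].
have ndvd (x : int) : ~~ (p %| l + x)%Z -> A * x + B != 0.
  move=> px; apply/eqP => h; suff : (p %| A * (l + x))%Z.
    by rewrite Euclid_dvdzM // (negPf pA) (negPf px).
  by have <- : A * l - B = A * (l + x) by rewrite -[RHS]subr0 -h; ring.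
by rewrite mulf_neq0 ?ndvd.
Qed.

Let sum (w : 'I_M * 'I_M) : int := (w.1 : nat)%:Z + (w.2 : nat)%:Z.
Let prd (w : 'I_M * 'I_M) : int := (w.1 : nat)%:Z * (w.2 : nat)%:Z.

Let sum_prd_dvd w1 w2 : w1 \in S -> w2 \in S ->
  (p %| (prd w1 - prd w2) + l * (sum w1 - sum w2))%Z.
Proof.
move=> w1S w2S; have h1 := S_hyp w1S; have h2 := S_hyp w2S.
by have := rpredB h1 h2; apply: eq_dvdz; rewrite /prd /sum; ring.
Qed.

Let sum_bound w : 0 <= sum w <= 2 * M%:Z - 2.
Proof. by rewrite /sum; have := ltn_ord w.1; have := ltn_ord w.2; lia. Qed.

Let prd_bound w : 0 <= prd w < M%:Z ^+ 2.
Proof. by rewrite /prd; have := ltn_ord w.1; have := ltn_ord w.2; nia. Qed.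

Let sum_diff w1 w2 : `|sum w1 - sum w2| <= 2 * M%:Z.
Proof. by have := sum_bound w1; have := sum_bound w2; lia. Qed.

Let prd_diff w1 w2 : `|prd w1 - prd w2| < M%:Z ^+ 2.
Proof. by have := prd_bound w1; have := prd_bound w2; lia. Qed.

(** Fixing the linear combination [A * prd w + B * sum w] therefore puts [w] on one integer
    hyperbola. *)
Let affine_prd (A B : int) (w : 'I_M * 'I_M) :
   (A * (w.1 : nat)%:Z + B) * (A * (w.2 : nat)%:Z + B) =
  A * (A * prd w + B * sum w) + B ^+ 2.
Proof. by rewrite /prd /sum; ring. Qed.

(** Every quantity shown divisible by [p] here has size at most [4 M^3], so it vanishes over the
    integers. *)
Lemma card_hyperbola_small : (0 < M)%N -> (4 * M ^ 3 < p)%N ->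
  exists n, [/\ (0 < n)%N, (#|S| <= 2 * size (divisors n))%N & (n <= 9 * M ^ 4)%N].
Proof.
move=> M0 ltMp; have M4 : (0 < 9 * M ^ 4)%N by rewrite muln_gt0 expn_gt0 M0.
have small_eq0 (x : int) : `|x| <= 4 * M%:Z ^+ 3 -> (p %| x)%Z -> x = 0.
  by move=> x_le /dvdz_norm_lt; apply; apply: le_lt_trans x_le _; rewrite -PoszX; lia.
have m1 : 1 <= M%:Z ^+ 1 by rewrite expr1 lez_nat.
have m2 : M%:Z <= M%:Z ^+ 2 by rewrite ler_eXnr.
have m3 : M%:Z ^+ 2 <= M%:Z ^+ 3 by rewrite ler_weXn2l.
have [->|[w1 w1S]] := set_0Vmem S; first by exists 1%N; rewrite cards0.
(* If all the sums agree, [u + v] and [u * v] are fixed, so [S] has at most two elements. *)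
case: (boolP [exists w in S, sum w != sum w1]); last first.
  rewrite negb_exists => /forallP eq_sum; exists 1%N; split=> //.
  suff /subset_leq_card : S \subset [set w1; (w1.2, w1.1)].
    by move/leq_trans; apply; rewrite cards2; case: eqP.
  apply/fintype.subsetP => w wS; rewrite !inE.
  have := eq_sum w; rewrite wS /= negbK => /eqP sE.
  have := sum_prd_dvd wS w1S; rewrite sE subrr mulr0 addr0 => /small_eq0 pE.
  have {pE} : prd w - prd w1 = 0 by apply: pE; have := prd_diff w w1; lia.
  move: sE; rewrite /sum /prd; case: w wS => u v _; case: (w1) => u1 v1 /= sE pE.
  (* With equal sums and products, [u] is a root of the quadratic with roots [u1] and [v1]. *)
  have : ((u : nat)%:Z - (u1 : nat)%:Z) * ((u : nat)%:Z - (v1 : nat)%:Z) = 0.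
    have vE : (v : nat)%:Z = (u1 : nat)%:Z + (v1 : nat)%:Z - (u : nat)%:Z by lia.
    by rewrite -[RHS]oppr0 -pE vE; ring.
  move=> /eqP; rewrite mulf_eq0 !subr_eq0 => /orP[]/eqP[/val_inj eu]; apply/orP.
    by left; apply/eqP; congr (_, _) => //; apply: val_inj => /=; move: sE; rewrite eu; lia.
  by right; apply/eqP; congr (_, _) => //; apply: val_inj => /=; move: sE; rewrite eu; lia.
case/exists_inP => w2 w2S neq_s.
(* [A, B] is proportional to [1, l] mod [p], as [w1] and [w2] lie on the hyperbola. *)
pose A := sum w2 - sum w1; pose B := prd w1 - prd w2.
have A0 : A != 0 by rewrite subr_eq0.
have A_le := sum_diff w2 w1; have B_le := prd_diff w1 w2; rewrite -/A -/B in A_le B_le.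
have pA : ~~ (p %| A)%Z by apply: contra A0 => /small_eq0 ->//; lia.
have pB : (p %| A * l - B)%Z.
  by have := sum_prd_dvd w2S w1S; apply: eq_dvdz; rewrite /A /B; ring.
pose D := (A * (w1.1 : nat)%:Z + B) * (A * (w1.2 : nat)%:Z + B).
have D0 : D != 0 by apply: affine_values_neq0.
exists `|D|%N; split; first by rewrite absz_gt0.
  apply: (@card_int_hyperbola _ A B) => // w wS; rewrite /D !affine_prd.
  (* This determinant eliminates [l] from the relations of [w] and [w2] with [w1]; each of its two
     terms is at most [2 M^3]. *)
  have : A * (prd w - prd w1) + B * (sum w - sum w1) = 0.
    apply: small_eq0.
      rewrite (_ : 4 * _ = 2 * M%:Z * M%:Z ^+ 2 + M%:Z ^+ 2 * (2 * M%:Z)); last by ring.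
      apply: le_trans (ler_normD _ _) _; rewrite !normrM.
      by rewrite lerD // ler_pM ?(ltW (prd_diff _ _)) // ltW.
    rewrite (_ : _ + _ = A * ((prd w - prd w1) + l * (sum w - sum w1))
       - (A * l - B) * (sum w - sum w1)); last by ring.
    apply: rpredB; [exact/dvdz_mull/sum_prd_dvd | exact: dvdz_mulr].
  by move=> h; congr (A * _ + _); apply: subr0_eq; rewrite -h; ring.
have fac_le (u : 'I_M) : `|A * (u : nat)%:Z + B| <= 3 * M%:Z ^+ 2.
  rewrite (_ : 3 * _ = 2 * M%:Z * M%:Z + M%:Z ^+ 2); last by ring.
  apply: le_trans (ler_normD _ _) _; rewrite normrM lerD ?(ltW B_le) // ler_pM //.
  by rewrite ger0_norm // lez_nat ltnW.
suff : `|D| <= 9 * M%:Z ^+ 4 by rewrite -PoszX; lia.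
rewrite normrM (_ : 9 * _ = (3 * M%:Z ^+ 2) * (3 * M%:Z ^+ 2)); last by ring.
by apply: ler_pM.
Qed.

Lemma card_hyperbola_large : (0 < M < p)%N ->
  exists Z n, [/\ (0 < n)%N, (#|S| <= (2 * Z).+1 * (2 * size (divisors n)))%N,
   (n <= 4 * p ^ 4)%N & (Z ^ 2 * p <= 25 * M ^ 3)%N].
Proof.
move=> Mp; have [M0 ltMp] := andP Mp; have p0 := prime_gt0 pp.
have [T [T0 ltTp T_le p_lt]] := sqrt_ratio Mp.
have [t [l0 [/andP[t0 letT] l0_lt tl]]] := dirichlet_approximation l p0 T0.
pose Z := ((T * M ^ 2 + 2 * M * `|l0|) %/ p)%N.
have Z_sq := quotient_count M0 p0 T0 T_le p_lt l0_lt (leq_divM _ p).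
exists Z.
suff [n [n0 Sn n_le]] : exists n, [/\ (0 < n)%N,
    (#|S| <= (2 * Z).+1 * (2 * size (divisors n)))%N & (n <= 4 * p ^ 4)%N] by exists n.
have X0 : (0 < 4 * p ^ 4)%N by rewrite muln_gt0 expn_gt0 p0.
have [->|[w1 w1S]] := set_0Vmem S; first by exists 1%N; rewrite cards0.
(* [F w] is the relation between [w] and [w1] multiplied by [t], with [t l] replaced by the small
   residue [l0]. It is a multiple of [p], and its quotient is at most [Z] in absolute value. *)
pose F w := t%:Z * (prd w - prd w1) + l0 * (sum w - sum w1).
have F_dvd w : w \in S -> (p %| F w)%Z.
  move=> wS; rewrite (_ : F w = t%:Z * ((prd w - prd w1) + l * (sum w - sum w1))
       - (t%:Z * l - l0) * (sum w - sum w1)); last by rewrite /F; ring.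
  by apply: rpredB; [exact/dvdz_mull/sum_prd_dvd | exact: dvdz_mulr].
have F_le w : `|F w| <= (T * M ^ 2 + 2 * M * `|l0|)%N%:Z.
  rewrite (_ : Posz _ = T%:Z * M%:Z ^+ 2 + `|l0| * (2 * M%:Z)); last by rewrite -PoszX; lia.
  apply: le_trans (ler_normD _ _) _; rewrite !normrM.
  by rewrite lerD // ler_pM ?(ltW (prd_diff _ _)) // ltW.
pose z w := (F w %/ p)%Z.
have zE w : w \in S -> F w = z w * p%:Z by move/F_dvd => pF; rewrite divzK.
have z_le w : w \in S -> `|z w| <= Z%:Z.
  move=> wS; have := F_le w; rewrite zE // normrM => zp_le.
  suff : (`|z w|%N <= Z)%N by lia.
  by rewrite leq_divRL //; lia.
(* The shift by [Z] sends [[-Z, Z]] to [[0, 2 Z]], so on [S] the default value of [inord] never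
   occurs. *)
pose cls w : 'I_(2 * Z).+1 := inord (absz (z w + Z%:Z)).
have [c S_le] := pigeonhole cls S (ltn0Sn _).
set Sc := [set w in S | cls w == c] in S_le.
have [Sc0|[w0 w0S]] := set_0Vmem Sc.
  by exists 1%N; split=> //; apply: leq_trans S_le _; rewrite Sc0 cards0 muln0.
have F_const w : w \in Sc -> F w = F w0.
  move: w0S; rewrite !inE => /andP[w0S /eqP <-] /andP[wS /eqP /(congr1 val)/=].
  have := shift_bound (z_le _ wS); have := shift_bound (z_le _ w0S).
  rewrite !zE // => ? ?.
  by rewrite !inordK // => /(shift_inj (z_le _ wS) (z_le _ w0S)) ->.
have {}w0S : w0 \in S by move: w0S; rewrite inE => /andP[].
pose D := (t%:Z * (w0.1 : nat)%:Z + l0) * (t%:Z * (w0.2 : nat)%:Z + l0).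
have pt : ~~ (p %| t%:Z)%Z.
  by rewrite dvdzE /=; apply/negP => /dvdn_leq -/(_ t0); lia.
have D0 : D != 0 by apply: affine_values_neq0.
exists `|D|%N; split; first by rewrite absz_gt0.
  apply: leq_trans S_le _; rewrite leq_mul2l; apply/orP; right.
  apply: (@card_int_hyperbola _ t%:Z l0) => // [|w wS]; first by lia.
  rewrite /D !affine_prd; congr (_ * _ + _); apply: subr0_eq.
  by have := F_const _ wS => h; rewrite -(subrr (F w0)) -{1}h /F; ring.
have l0_le : (`|l0| <= p)%N by apply: leq_trans (ltnW l0_lt); rewrite leq_pmulr.
have fac_le (u : 'I_M) : `|t%:Z * (u : nat)%:Z + l0| <= 2 * p%:Z ^+ 2.
  rewrite (_ : 2 * _ = p%:Z * p%:Z + p%:Z ^+ 2); last by ring.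
  apply: le_trans (ler_normD _ _) _; rewrite normrM lerD // ?ler_pM //.
  - by rewrite ger0_norm // lez_nat (leq_trans letT (ltnW ltTp)).
  - by rewrite ger0_norm // lez_nat ltnW // (ltn_trans (ltn_ord u)).
  - by apply: (@le_trans _ _ p%:Z); [lia | rewrite ler_eXnr // lez_nat].
suff : `|D| <= 4 * p%:Z ^+ 4 by rewrite -PoszX; lia.
rewrite normrM (_ : 4 * _ = (2 * p%:Z ^+ 2) * (2 * p%:Z ^+ 2)); last by ring.
by apply: ler_pM.
Qed.
End ModularHyperbola.

(** If [p <= 4 M^3], then [4 p^4 <= 4 (4 M^3)^4 = 1024 M^12]. The other range of [p] is covered with
    [Z = 0]. *)
Lemma card_modular_hyperbola (p M : nat) (l lam : int) (S : {set 'I_M * 'I_M}) :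
  prime p -> (0 < M < p)%N -> ~~ (p %| lam)%Z ->
  (forall w, w \in S ->
     (p %| (l + (w.1 : nat)%:Z) * (l + (w.2 : nat)%:Z) - lam)%Z) ->
  exists Z n, [/\ (0 < n)%N, (#|S| <= (2 * Z).+1 * (2 * size (divisors n)))%N,
    (n <= 1024 * M ^ 12)%N & (Z ^ 2 * p <= 25 * M ^ 3)%N].
Proof.
move=> pp Mp lam0 S_hyp; have [M0 _] := andP Mp.
have [ltMp|leMp] := ltnP (4 * M ^ 3) p.
  have [n [n0 Sn n_le]] := card_hyperbola_small pp lam0 S_hyp M0 ltMp.
  exists 0%N, n; split; rewrite ?mul1n //; apply: leq_trans n_le _.
  by rewrite leq_mul // leq_pexp2l.
have [Z [n [n0 Sn n_le Z_le]]] := card_hyperbola_large pp lam0 S_hyp Mp.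
exists Z, n; split=> //; apply: leq_trans n_le _.
rewrite (_ : 1024 * M ^ 12 = 4 * (4 * M ^ 3) ^ 4)%N.
  by rewrite leq_mul2l leq_exp2r.
by rewrite expnMn -expnM mulnA.
Qed.

(** * From the exponential congruence to a hyperbola *)

Lemma intr_Fp_eq0 (p : nat) (z : int) : prime p ->
  ((z%:~R : 'F_p) == 0) = (p %| z)%Z.
Proof. by move=> pp; rewrite -(dvdz_pcharf (pchar_Fp pp)). Qed.

(** By Fermat's little theorem the order divides [p - 1]. *)
Lemma prim_root_Fp_lt (p t : nat) (x : 'F_p) : prime p ->
  t.-primitive_root x -> (t < p)%N.
Proof.
move=> pp x_prim; have t0 := prim_order_gt0 x_prim.
have x0 : x != 0 by rewrite (prim_root_eq0 x_prim) -lt0n.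
have := expf_card x; rewrite card_Fp // (_ : x ^+ p = x * x ^+ p.-1); last first.
  by rewrite -exprS prednK ?prime_gt0.
rewrite -[RHS]mulr1.
move=> /(mulfI x0)/eqP; rewrite -(prim_order_dvd x_prim) => /dvdn_leq le_tp.
by have := prime_gt1 pp; lia.
Qed.

Lemma J_sq_le (p : nat) (g : int) (t M : nat) (a K L : int) :
  prime p -> t.-primitive_root (g%:~R : 'F_p) -> (0 < M)%N -> (M < t)%N ->
  coprimez a p%:Z ->
  exists Z n, [/\ (0 < n)%N,
    (J p g a M K L ^ 2 <= (2 * M) * ((2 * Z).+1 * (2 * size (divisors n))))%N,
    (n <= 1024 * M ^ 12)%N & (Z ^ 2 * p <= 25 * M ^ 3)%N].
Proof.
move=> pp g_prim M0 ltMt a_p; have ltMp := ltn_trans ltMt (prim_root_Fp_lt pp g_prim).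
set gp : 'F_p := g%:~R; set ap : 'F_p := a%:~R.
have t0 := prim_order_gt0 g_prim.
have g0 : gp != 0 by rewrite (prim_root_eq0 g_prim) -lt0n.
have a0 : ap != 0.
  rewrite intr_Fp_eq0 // dvdzE /= -prime_coprime // coprime_sym.
  by move: a_p; rewrite coprimezE.
rewrite /J; set A := [set ij | _].
have inA (w : 'I_M * 'I_M) : w \in A ->
    ((L + 1 + (w.2 : nat)%:Z)%:~R : 'F_p) = ap * gp ^ (K + 1 + (w.1 : nat)%:Z).
  by rewrite inE => /eqP.
have lt2M (w : ('I_M * 'I_M) * ('I_M * 'I_M)) : (w.1.1 + w.2.1 < 2 * M)%N.
  by have := ltn_ord w.1.1; have := ltn_ord w.2.1; lia.
have M2 : (0 < 2 * M)%N by rewrite muln_gt0.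
have [c] := pigeonhole (fun w => Ordinal (lt2M w)) (finset.setX A A) M2.
rewrite cardsX mulnn; set F := [set w in _ | _] => A_le.
have inF w : w \in F -> [/\ w.1 \in A, w.2 \in A & (w.1.1 + w.2.1 = c)%N].
  by rewrite !inE => /andP[/andP[-> ->] /eqP <-].
pose h (w : ('I_M * 'I_M) * ('I_M * 'I_M)) := (w.1.2, w.2.2).
(* Equal second coordinates give equal powers of [g]; both indices are below the order [t], so they
   coincide. *)
have A_inj (w w' : 'I_M * 'I_M) : w \in A -> w' \in A -> w.2 = w'.2 -> w = w'.
  case: w w' => i j [i' j'] /inA /= e /inA /= e' jj; rewrite -{}jj {}e in e' *.
  congr (_, _); apply: val_inj; move/(mulfI a0): e'.
  rewrite !(expfzDr (K + 1) _ g0) => /(mulfI (expfz_neq0 (K + 1) g0))/eqP.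
  rewrite -!exprnP (eq_prim_root_expr g_prim) /= !modn_small; first by move/eqP.
    by rewrite (ltn_trans _ ltMt).
  by rewrite (ltn_trans _ ltMt).
have h_inj : {in F &, injective h}.
  move=> [w1 w2] [w1' w2'] /inF[/= a1 a2 _] /inF[/= a1' a2' _] [e1 e2].
  by rewrite (A_inj w1 w1') // (A_inj w2 w2').
(* Indices are offsets from [K + 1], so two points with index sum [c] have exponents summing to
   [2 (K + 1) + c]. The representative of [x] in [[0, p)] serves as [lam]. *)
pose x : 'F_p := ap ^+ 2 * gp ^ (2 * (K + 1) + (c : nat)%:Z).
have x_lift : ((x : nat)%:Z)%:~R = x by rewrite -pmulrn natr_Zp.
have x_ndvd : ~~ (p %| (x : nat)%:Z)%Z.
  by rewrite -intr_Fp_eq0 // x_lift mulf_neq0 ?expf_neq0 ?expfz_neq0.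
have h_hyp (w : 'I_M * 'I_M) : w \in h @: F ->
    (p %| (L + 1 + (w.1 : nat)%:Z) * (L + 1 + (w.2 : nat)%:Z) - (x : nat)%:Z)%Z.
  move=> /imsetP[v /inF[a1 a2 vc] ->]; rewrite -intr_Fp_eq0 // rmorphB rmorphM /=.
  rewrite x_lift (inA _ a1) (inA _ a2) subr_eq0 mulrACA -expr2 -expfzDr //.
  by rewrite /x -vc PoszD; apply/eqP; congr (_ * _ ^ _); ring.
have Mp : (0 < M < p)%N by rewrite M0.
have [Z [n [n0 S_le n_le Z_le]]] := card_modular_hyperbola pp Mp x_ndvd h_hyp.
exists Z, n; split=> //; apply: leq_trans A_le _.
by rewrite leq_mul2l -(card_in_imset h_inj) S_le orbT.
Qed.

(** * The final estimate over the reals *)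

Theorem corollary3 (R : realType) (eps : R) (heps : 0 < eps) :
  exists (p0 : nat) (c : R), 0 < c /\
    forall (p : nat) (g : int) (t M : nat) (a K L : int),
      prime p -> (p0 <= p)%N ->
      2 <= g -> coprimez g p%:Z ->
      t.-primitive_root (g%:~R : 'F_p) ->
      (1 <= M)%N -> (M < t)%N ->
      coprimez a p%:Z ->
      (J p g a M K L)%:R <
        c * (1 + M%:R `^ (3%:R / 4%:R) * p%:R `^ (- (1 / 4%:R)))
          * M%:R `^ (1 / 2%:R + eps).
Proof.
(* As [n <= 1024 M^12], bounding the divisor count by a constant times [M^(2 eps)] requires
   [12 <= 2 k eps]. *)
pose k := (Num.truncn (6 / eps)).+1.
have k_gt : 6 < k%:R * eps by rewrite -ltr_pdivrMr // truncnS_gt.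
have [C C0 div_le] := divisor_bound k.
pose D : R := (C * 1024)%N%:R.
have D1 : 1 <= D by rewrite ler1n muln_gt0 C0.
(* Squaring the target leads to the factor [40 D = 2 * 10 * 2 * D]; strictness comes from
   [40 D < (40 D + 1)^2]. *)
exists 0%N, (40 * D + 1); split; first by lra.
move=> p g t M a K L pp _ _ _ g_prim M0 ltMt a_p.
have [Z [n [n0 J_le n_le Z_le]]] := J_sq_le K L pp g_prim M0 ltMt a_p.
set m : R := M%:R; set q : R := p%:R.
have m1 : 1 <= m by rewrite ler1n.
have q0 : 0 < q by rewrite ltr0n prime_gt0.
set X := m `^ _ * q `^ _.
have X0 : 0 <= X by rewrite mulr_ge0 ?powR_ge0.
(* This identity replaces the real powers in [X] and turns [Z^2 p <= 25 M^3] into [Z <= 5 X^2]. *)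
have X4 : X ^+ 4 * q = m ^+ 3.
  rewrite exprMn -!powR_mulrn ?powR_ge0 // -!powRrM.
  rewrite (_ : 3%:R / 4%:R * 4%:R = 3%:R); last by field.
  rewrite (_ : - (1 / 4%:R) * 4%:R = -1); last by field.
  by rewrite powR_inv1 ?(ltW q0) // -mulrA mulVf ?mulr1 ?gt_eqF.
clearbody X.
have Z_X : Z%:R <= 5 * X ^+ 2.
  rewrite -ler_sqr ?nnegrE ?mulr_ge0 ?exprn_ge0 // -(ler_pM2r q0).
  rewrite (_ : (5 * X ^+ 2) ^+ 2 * q = 25 * m ^+ 3); last by rewrite -X4; ring.
  by rewrite -!natrX -!natrM ler_nat.
pose d : R := (size (divisors n))%:R.
pose Y := m `^ eps.
have Y0 : 0 < Y by rewrite powR_gt0 // (lt_le_trans ltr01).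
have d_le : d <= D * Y ^+ 2.
  have Yk : m ^+ 12 <= (Y ^+ 2) ^+ k.
    rewrite -exprM -!powR_mulrn ?powR_ge0 ?(le_trans ler01 m1) //.
    rewrite -powRrM ler_powR // natrM; lra.
  rewrite -(@ler_pXn2r _ k) ?nnegrE ?mulr_ge0 ?exprn_ge0 ?ler0n ?(le_trans ler01 D1) ?(ltW Y0) //.
  apply: le_trans (_ : (C * n)%N%:R <= _).
    by rewrite -natrX ler_nat div_le.
  apply: le_trans (_ : D * m ^+ 12 <= _).
    by rewrite -natrX -natrM ler_nat -mulnA leq_mul2l n_le orbT.
  rewrite exprMn ler_pM ?exprn_ge0 ?(le_trans ler01) //.
  by rewrite ler_eXnr.
have mY : m `^ (1 / 2%:R + eps) ^+ 2 = m * Y ^+ 2.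
  rewrite powRD ?(gt_eqF (lt_le_trans ltr01 m1)) ?implybT // exprMn; congr (_ * _).
  rewrite -powR_mulrn ?powR_ge0 // -powRrM (_ : 1 / 2%:R * 2%:R = 1 :> R); last by field.
  by rewrite powRr1 // (le_trans ler01).
set W := m `^ _ in mY *.
have W0 : 0 < W by rewrite powR_gt0 // (lt_le_trans ltr01).
have J_leR : (J p g a M K L)%:R ^+ 2 <= 2 * m * ((2 * Z%:R + 1) * (2 * d)) :> R.
  rewrite -natrX; apply: le_trans (_ : (2 * M * ((2 * Z).+1 * (2 * size (divisors n))))%N%:R <= _).
    by rewrite ler_nat.
  by rewrite -[(2 * Z).+1]addn1 !(natrM, natrD).
have c0 : 0 < 40 * D + 1 by lra.
rewrite -ltr_sqr ?nnegrE ?ler0n ?mulr_ge0 ?(ltW c0) ?(ltW W0) ?addr_ge0 //.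
apply: le_lt_trans J_leR _.
apply: le_lt_trans (_ : 40 * D * (1 + X) ^+ 2 * W ^+ 2 < _).
  rewrite mY.
  have ZX : 2 * Z%:R + 1 <= 10 * (1 + X) ^+ 2 by rewrite sqrrD; nra.
  rewrite (_ : 40 * D * _ * _ = 2 * m * ((10 * (1 + X) ^+ 2) * (2 * (D * Y ^+ 2)))); last by ring.
  rewrite ler_wpM2l ?mulr_ge0 ?ler0n // ler_pM ?mulr_ge0 ?addr_ge0 ?ler0n //.
  by rewrite ler_pM2l.
rewrite !exprMn !ltr_pM2r ?exprn_gt0 //; last by lra.
nra.
Qed.
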